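(* Let $I\subset\mathbb{R}$ be a nonempty connected set and $\Phi:I\to\mathbb{R}$ a convex function. Suppose that: (1) $\mu$ is a finite positive countably additive measure on $X$ and $0\ne\mu\le\nu$ for some positive countably additive measure $\nu$ on $X$; (2) the image $\operatorname{im}\Phi\subset\mathbb{R}$ is connected, i.e. an interval, and the function $\sup\Phi^{-1}$ is increasing on $\operatorname{im}\Phi$; (3) $u,v\in L^1(X,\mu)$, $u(x)-v(x)\in I$ for $\mu$-almost all $x\in X$, and the composition $\Phi\circ(u-v)$ is $\nu$-integrable on $X$; (4) the function $\Phi\circ(u-v)$ is positive (i.e. $\ge 0$) on a subset of $X$ on which the difference of measures $\nu-\mu\ge0$ is concentrated, and $$\frac1{\mu(X)}\int_X\Phi\circ(u-v)\,d\nu\in\operatorname{im}\Phi .$$ Then $$\frac1{\mu(X)}\int_Xu\,d\mu\le\frac1{\mu(X)}\int_Xv\,d\mu+\sup\Phi^{-1}\Bigl(\frac1{\mu(X)}\int_X\Phi\circ(u-v)\,d\nu\Bigr),$$ and if $\Phi$ is strictly increasing (hence invertible), $\sup\Phi^{-1}$ on the right-hand side may be replaced by the ordinary inverse $\Phi^{-1}$.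
   Context: $\mu$ and $\nu$ are measures on the same measurable space $X$. $L^1(X,\mu)$ is the class of real-valued functions defined $\mu$-almost everywhere on $X$ and $\mu$-integrable. $I$ is an interval, bounded or not, open or containing one or both of its real endpoints, possibly a single point. Convex means $\Phi(at_1+(1-a)t_2)\le a\Phi(t_1)+(1-a)\Phi(t_2)$ for all $t_1,t_2\in I$, $0\le a\le1$ (no continuity at endpoints is assumed). The $\sup$-inverse of $\Phi$ is the function $$\sup\Phi^{-1}:\ y\mapsto\sup\bigl(\Phi^{-1}(\{y\})\bigr)=\sup\{t\in I:\Phi(t)=y\},\qquad y\in\operatorname{im}\Phi .$$ ''Increasing'' is meant in the non-strict sense. A positive measure $\kappa$ on $X$ is concentrated on $X_\kappa\subset X$ if $\kappa(X\setminus X_\kappa)=0$. *)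

(* Defs.v *)
From HB Require Import structures.
From mathcomp Require Import all_boot all_order all_algebra.
From mathcomp Require Import all_classical all_reals all_analysis.
Set Implicit Arguments.
Unset Strict Implicit.
Unset Printing Implicit Defensive.
Import Order.TTheory GRing.Theory Num.Theory.
Import numFieldNormedType.Exports.

Local Open Scope classical_set_scope.
Local Open Scope ring_scope.

(* A partially defined real function on T is given by a domain D : set T and
   f : T -> R, only the values of f on D being relevant.  It belongs to
   L^1(T, mu) when it is defined, measurable and integrable on a measurable set
   of full measure.  D itself need not be measurable; the integral of f is
   nevertheless \int[mu]_(x in D) f x, because the library's integral, a
   supremum over simple functions, is insensitive to mu-null sets even for
   non-measurable integrands. *)
Definition in_L1 d (T : measurableType d) (R : realType)
    (mu : {measure set T -> \bar R}) (D : set T) (f : T -> R) : Prop :=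
  exists E : set T, [/\ measurable E, E `<=` D, mu (~` E) = 0%E
                      & mu.-integrable E (EFin \o f)].

(* The domain of Phi \o (u - v), for u, v and Phi of domains Du, Dv and I. *)
Definition comp_sub_dom (T : Type) (R : realType) (I : set R)
    (Du : set T) (u : T -> R) (Dv : set T) (v : T -> R) : set T :=
  [set x | [/\ Du x, Dv x & I (u x - v x)]].

(* Extended-real valued: the level set may be unbounded above, e.g. when Phi is
   constant on I = R. *)
Definition sup_inv (R : realType) (I : set R) (Phi : R -> R) (y : R) : \bar R :=
  ereal_sup [set t%:E | t in I `&` Phi @^-1` [set y]].

(* Main.v *)
Require Import Defs.
From HB Require Import structures.
From mathcomp Require Import all_boot all_order all_algebra.
From mathcomp Require Import all_classical all_reals all_analysis.
From mathcomp Require Import measurable_realfun lra ring.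
Import Order.TTheory GRing.Theory Num.Theory.
Import numFieldNormedType.Exports.

Local Open Scope classical_set_scope.
Local Open Scope ring_scope.

(** The theorem is Jensen's inequality for the measure mu, followed by a
    comparison of the integrals for mu and nu and by one use of the
    monotonicity of the sup-inverse.  Put w = u - v and let t be the mean of w
    for mu.

    - An interval containing the values of w contains t
      ([mean_in_interval]), and Phi t is at most the mu-mean of Phi \o w
      ([Jensen_inequality]).  Phi need not be continuous at the endpoints of I
      and may have no support line there.  This does no harm: if t is an
      endpoint of I, then w lies on one side of its own mean, hence equals t
      almost everywhere ([one_sided_mean_ae]), and Jensen's inequality is an
      equality.  If t is interior, integrate a support line of Phi at t
      ([convex_support_line]).
    - Let Y carry the difference of nu and mu.  Outside Y the measures mu and nu agree, and on Y, where Phi \o w >= 0,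
      the larger measure gives the larger integral; so the mu-integral of
      Phi \o w is at most its nu-integral ([le_measure_Rintegral]).

    Together they give Phi t <= y, whence
    t <= sup_inv (Phi t) <= sup_inv y, and t is the difference of the means of
    u and v.  If Phi is strictly increasing, and s in I satisfies Phi s = y,
    then Phi t <= Phi s forces t <= s directly.

    The functions are only defined on possibly non-measurable sets; by
    [Rintegral_full_subset] their integrals can be restricted to measurable
    subsets of full measure, where the usual calculus applies. *)

(** * Integrals over non-measurable sets containing a full measurable set *)

Section full_set.
Set Implicit Arguments.
Unset Strict Implicit.
Context d (T : measurableType d) (R : realType) (mu : {measure set T -> \bar R}).
Local Open Scope ereal_scope.
Import HBNNSimple.

(** A simple function below f on D can be cut off outside E: the cut-off
    function is below f on E and has the same integral, so the two suprema
    defining the integrals agree without any measurability of f or D. *)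
Lemma ge0_integral_full_subset (D E : set T) (f : T -> \bar R) :
  measurable E -> E `<=` D -> mu (~` E) = 0 -> (forall x, 0 <= f x) ->
  \int[mu]_(x in D) f x = \int[mu]_(x in E) f x.
Proof.
move=> mE ED muE f0; rewrite !ge0_integralE//.
apply/eqP; rewrite eq_le; apply/andP; split.
- apply: ge_ereal_sup => _ [h /= hf <-]; apply: ereal_sup_ubound.
  exists (proj_nnsfun h mE).
    move=> x; rewrite -mrestrict /patch; case: ifPn => // xE.
    by have := hf x; rewrite /patch mem_set//; exact/ED/set_mem.
  rewrite -mrestrict -integral_nnsfun// -integralT_nnsfun.
  rewrite [RHS](ge0_negligible_integral (N := ~` E)) ?setTD ?setCK//.
  + exact: measurableC.
  + exact/measurable_EFinP.
  + by move=> x _; rewrite lee_fin.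
- apply: le_ereal_sup => _ [h /= hf <-]; exists h => // x.
  apply: le_trans (hf x) _; rewrite /patch; case: ifPn => xE.
    by rewrite mem_set//; exact/ED/set_mem.
  by case: ifP.
Qed.

Lemma Rintegral_full_subset (D E : set T) (f : T -> R) :
  measurable E -> E `<=` D -> mu (~` E) = 0 ->
  (\int[mu]_(x in D) f x = \int[mu]_(x in E) f x)%R.
Proof.
move=> mE ED muE; congr fine; rewrite integralE [RHS]integralE.
by congr (_ - _); apply: ge0_integral_full_subset.
Qed.

Lemma measure_full_set (E : set T) : measurable E -> mu (~` E) = 0 ->
  mu E = mu [set: T].
Proof.
move=> mE E0; rewrite -(setUv E) measureU ?setICr//; last exact: measurableC.
by rewrite [X in _ + X]E0 adde0.
Qed.

Lemma null_setCI (A B : set T) : measurable A -> measurable B ->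
  mu (~` A) = 0 -> mu (~` B) = 0 -> mu (~` (A `&` B)) = 0.
Proof.
by move=> mA mB A0 B0; rewrite setCI measureU0//; exact: measurableC.
Qed.

End full_set.

(** * Comparison of the integrals for two measures *)

Section measure_comparison.
Set Implicit Arguments.
Unset Strict Implicit.
Context d (T : measurableType d) (R : realType).
Variables mu nu : {measure set T -> \bar R}.
Local Open Scope ereal_scope.
Hypothesis mu_le_nu : forall A, measurable A -> mu A <= nu A.

Lemma ge0_le_measure_integral_in (E : set T) (f : T -> \bar R) :
  measurable E -> measurable_fun E f -> (forall x, E x -> 0 <= f x) ->
  \int[mu]_(x in E) f x <= \int[nu]_(x in E) f x.
Proof.
move=> mE mf f0; rewrite integral_mkcond [leRHS]integral_mkcond.
apply: ge0_le_measure_integral => //.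
  by move=> x; rewrite /patch; case: ifPn => // /set_mem/f0.
by apply/(measurable_restrictT f mE).
Qed.

Lemma le_measure_integrable (E : set T) (f : T -> \bar R) :
  measurable E -> nu.-integrable E f -> mu.-integrable E f.
Proof.
move=> mE /integrableP[mf foo]; apply/integrableP; split=> //.
apply: le_lt_trans foo; apply: ge0_le_measure_integral_in => //.
exact: measurableT_comp.
Qed.

(** A strict inequality on A could not be compensated on Z `\` A, where mu is
    again below nu; finiteness of mu Z lets the second term be cancelled. *)
Lemma eq_measure_subset (Z A : set T) : measurable Z -> measurable A ->
  A `<=` Z -> mu Z < +oo -> nu Z - mu Z = 0 -> mu A = nu A.
Proof.
move=> mZ mA AZ Zoo numu.
have split_Z (m : {measure set T -> \bar R}) : m Z = m A + m (Z `\` A).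
  rewrite -measureU//; [by rewrite setDUK|exact: measurableD|].
  exact: setDIK.
have muZ : mu Z \is a fin_num by rewrite ge0_fin_numE.
have nuZ : nu Z = mu Z by rewrite -[LHS](subeK _ muZ) numu add0e.
have le_muZ B : measurable B -> B `<=` Z -> mu B \is a fin_num.
  by move=> mB BZ; rewrite ge0_fin_numE// (le_lt_trans _ Zoo)// le_measure ?inE.
have mZA : measurable (Z `\` A) by exact: measurableD.
have finZA : mu (Z `\` A) \is a fin_num by exact: le_muZ.
apply/eqP; rewrite eq_le mu_le_nu//= -(leeD2rE _ _ finZA) -split_Z -nuZ split_Z.
by rewrite leeD2l// mu_le_nu.
Qed.

(** Split E along Y: on Y the integrand is nonnegative and mu <= nu suffices;
    off Y it may be negative, but there mu and nu are the same measure. *)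
Lemma le_measure_Rintegral (E Y : set T) (f : T -> R) :
  measurable E -> measurable Y -> nu.-integrable E (EFin \o f) ->
  (forall x, Y x -> (0 <= f x)%R) ->
  mu (~` Y) < +oo -> nu (~` Y) - mu (~` Y) = 0 ->
  (\int[mu]_(x in E) f x <= \int[nu]_(x in E) f x)%R.
Proof.
move=> mE mY fnu f0 muY numu.
have fmu := le_measure_integrable mE fnu.
have mEY : measurable (E `&` Y) by exact: measurableI.
have mEY' : measurable (E `\` Y) by exact: measurableD.
have disj : [disjoint E `&` Y & E `\` Y].
  by apply/disj_setPS => x [[_ ?] []].
have EE : E = (E `&` Y) `|` (E `\` Y) by rewrite setUIDK.
rewrite EE !Rintegral_setU -?EE//.
apply: lerD.
  apply: fine_le.
  - by apply: integrable_fin_num => //; apply: integrableS fmu.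
  - by apply: integrable_fin_num => //; apply: integrableS fnu.
  - apply: ge0_le_measure_integral_in => //.
      by apply: (measurable_int nu); apply: integrableS fnu.
    by move=> x [_ /f0]; rewrite lee_fin.
rewrite le_eqVlt; apply/orP; left; apply/eqP; congr fine.
apply: eq_measure_integral => A mA AEY.
apply: (@eq_measure_subset (~` Y)) => //; first exact: measurableC.
by move=> x /AEY[].
Qed.

End measure_comparison.

(** * Support lines of convex functions on the line *)

Section convex_real.
Set Implicit Arguments.
Unset Strict Implicit.
Variables (R : realType) (I : set R) (Phi : R -> R).
Hypothesis Phi_convex : convex_function (I : set (convex_lmodType R^o)) Phi.

Lemma convex_slope_le (s t r : R) : I s -> I r -> s < t -> t < r ->
  (Phi t - Phi s) / (t - s) <= (Phi r - Phi t) / (r - t).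
Proof.
move=> Is Ir st tr.
have sr : 0 < r - s by lra.
have a0 : 0 <= (r - t) / (r - s) by rewrite divr_ge0//; lra.
have a1 : (r - t) / (r - s) <= 1 by rewrite ler_pdivrMr//; lra.
(* t is the convex combination of s and r with weight p on s *)
pose p := (r - t) / (r - s).
have : Phi (p * s + (1 - p) * r) <= p * Phi s + (1 - p) * Phi r.
  exact: (Phi_convex (Itv01 a0 a1) (mem_set Is) (mem_set Ir)).
have -> : p * s + (1 - p) * r = t by rewrite /p; field; lra.
rewrite /p.
have -> : 1 - (r - t) / (r - s) = (t - s) / (r - s) by field; lra.
rewrite mulrAC [(t - s) / _ * _]mulrAC -mulrDl ler_pdivlMr// => le_chord.
rewrite ler_pdivrMr ?subr_gt0// mulrAC ler_pdivlMr ?subr_gt0//.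
nra.
Qed.

(** The slopes of the chords ending at t are bounded by those of the chords
    starting at t, so their supremum is the slope of a support line.  Points
    on both sides of t are needed for this supremum to exist. *)
Lemma convex_support_line (a b t : R) : I a -> I b -> I t -> a < t -> t < b ->
  exists c : R, forall s, I s -> Phi t + c * (s - t) <= Phi s.
Proof.
move=> Ia Ib It at_ tb.
pose S := [set (Phi t - Phi s) / (t - s) | s in I `&` [set s | s < t]].
have ubS r : I r -> t < r -> ubound S ((Phi r - Phi t) / (r - t)).
  by move=> Ir tr _ [s [Is /= st] <-]; exact: convex_slope_le.
have S0 : S !=set0 by exists ((Phi t - Phi a) / (t - a)); exists a.
exists (sup S) => s Is; have [st|ts|->] := ltgtP s t.
- have : (Phi t - Phi s) / (t - s) <= sup S.
    apply: ub_le_sup; last by exists s.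
    by exists ((Phi b - Phi t) / (b - t)); exact: ubS.
  by rewrite ler_pdivrMr ?subr_gt0//; lra.
- have : sup S <= (Phi s - Phi t) / (s - t) by apply: ge_sup => //; exact: ubS.
  by rewrite ler_pdivlMr ?subr_gt0//; lra.
- by rewrite subrr mulr0 addr0.
Qed.

End convex_real.

(** * Jensen's inequality *)

Definition mean d (T : measurableType d) (R : realType)
    (mu : {measure set T -> \bar R}) (F : set T) (w : T -> R) : R :=
  (fine (mu F))^-1 * \int[mu]_(x in F) w x.

Section mean.
Set Implicit Arguments.
Unset Strict Implicit.
Context d (T : measurableType d) (R : realType).
Variables (mu : {measure set T -> \bar R}) (F : set T).
Hypotheses (mF : measurable F) (F_neq0 : mu F != 0%E) (F_fin : (mu F < +oo)%E).

Let m := fine (mu F).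
Local Notation mean := (@mean d T R mu F).

Lemma fine_measure_gt0 : 0 < fine (mu F).
Proof. by apply: fine_gt0; rewrite lt0e F_neq0 measure_ge0. Qed.

Lemma integrable_cst_fin (c : R) : mu.-integrable F (EFin \o cst c).
Proof.
apply/integrableP; split; first exact/measurable_EFinP/measurable_cst.
under eq_integral do rewrite /=.
by rewrite integral_cst// lte_mul_pinfty.
Qed.

Lemma mean_cst (c : R) : mean (cst c) = c.
Proof.
by rewrite /mean Rintegral_cst// mulrC mulfK// gt_eqF// fine_measure_gt0.
Qed.

Lemma ge0_Rintegral_eq0_ae (g : T -> R) : mu.-integrable F (EFin \o g) ->
  (forall x, F x -> 0 <= g x) -> \int[mu]_(x in F) g x = 0 ->
  {ae mu, forall x, F x -> g x = 0}.
Proof.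
move=> gi g0 ig0; suff : ae_eq mu F (EFin \o g) (cst 0%E).
  by apply: filterS => x /[apply] -[].
apply/ae_eq_integral_abs => //; first exact: measurable_int gi.
rewrite -[RHS]/(0%:E) -ig0 /Rintegral fineK; last exact: integrable_fin_num.
by apply: eq_integral => x /set_mem/g0 gx; rewrite /= ger0_norm.
Qed.

Variable w : T -> R.
Hypothesis wi : mu.-integrable F (EFin \o w).

Let wE : \int[mu]_(x in F) w x = m * mean w.
Proof. by rewrite /mean mulrA mulfV ?mul1r// gt_eqF// fine_measure_gt0. Qed.

(** The difference of w and its mean has integral 0, and by hypothesis a
    constant sign. *)
Lemma one_sided_mean_ae :
  (forall x, F x -> w x <= mean w) \/ (forall x, F x -> mean w <= w x) ->
  {ae mu, forall x, F x -> w x = mean w}.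
Proof.
have ci := integrable_cst_fin (mean w).
have int0 : \int[mu]_(x in F) (cst (mean w) x - w x) = 0.
  by rewrite RintegralB// Rintegral_cst// wE mulrC subrr.
have int0' : \int[mu]_(x in F) (w x - cst (mean w) x) = 0.
  by rewrite RintegralB// Rintegral_cst// wE mulrC subrr.
case=> [wle|wge].
- suff : {ae mu, forall x, F x -> mean w - w x = 0}.
    by apply: filterS => x /[apply]; lra.
  apply: ge0_Rintegral_eq0_ae int0; first exact: integrableB ci wi.
  by move=> x /wle; rewrite subr_ge0.
- suff : {ae mu, forall x, F x -> w x - mean w = 0}.
    by apply: filterS => x /[apply]; lra.
  apply: ge0_Rintegral_eq0_ae int0'; first exact: integrableB wi ci.
  by move=> x /wge; rewrite subr_ge0.
Qed.

(** If w were everywhere strictly above, or strictly below, its mean, it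
    would also equal it almost everywhere, making F a null set; so the mean
    lies between two values of w. *)
Lemma mean_in_interval (I : set R) : is_interval I ->
  (forall x, F x -> I (w x)) -> I (mean w).
Proof.
move=> itvI wI.
have absurd : {ae mu, forall x, F x -> w x = mean w} ->
    (forall x, F x -> w x <> mean w) -> False.
  move=> [N [mN N0 sub]] neq; move/eqP : F_neq0; apply.
  apply: (subset_measure0 _ mN _ N0) => // x Fx; apply: sub => /=.
  by move=> /(_ Fx); exact: neq.
have [a Fa wa] : exists2 a, F a & w a <= mean w.
  apply: contrapT => no.
  have lt x : F x -> mean w < w x.
    by move=> Fx; rewrite ltNge; apply/negP => ?; apply: no; exists x.
  apply: absurd; first by apply: one_sided_mean_ae; right => x /lt/ltW.
  by move=> x /lt /[swap] ->; rewrite ltxx.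
have [b Fb wb] : exists2 b, F b & mean w <= w b.
  apply: contrapT => no.
  have lt x : F x -> w x < mean w.
    by move=> Fx; rewrite ltNge; apply/negP => ?; apply: no; exists x.
  apply: absurd; first by apply: one_sided_mean_ae; left => x /lt/ltW.
  by move=> x /lt /[swap] ->; rewrite ltxx.
by apply: (itvI (w a) (w b)); [exact: wI|exact: wI|rewrite wa wb].
Qed.

(** When I has points on both sides of the mean, integrate a support line
    there; otherwise w is almost everywhere constant. *)
Lemma Jensen_inequality (I : set R) (Phi : R -> R) : is_interval I ->
  convex_function (I : set (convex_lmodType R^o)) Phi ->
  (forall x, F x -> I (w x)) -> mu.-integrable F (EFin \o (Phi \o w)) ->
  Phi (mean w) <= mean (Phi \o w).
Proof.
move=> itvI Phi_convex wI Phii.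
have It := mean_in_interval itvI wI.
have one_sided :
    (forall x, F x -> w x <= mean w) \/ (forall x, F x -> mean w <= w x) ->
    Phi (mean w) <= mean (Phi \o w).
  move=> /one_sided_mean_ae wae.
  rewrite -[leLHS]mean_cst le_eqVlt; apply/orP; left; apply/eqP.
  congr (_ * fine _); apply: ae_eq_integral => //.
  - exact/measurable_EFinP/measurable_cst.
  - exact: measurable_int Phii.
  - by apply: filterS wae => x /[apply] /= ->.
have [[a Ia at_]|noa] := pselect (exists2 a, I a & a < mean w); last first.
  apply: one_sided; right => x Fx; rewrite leNgt; apply/negP => ?.
  by apply: noa; exists (w x); first exact: wI.
have [[b Ib tb]|nob] := pselect (exists2 b, I b & mean w < b); last first.
  apply: one_sided; left => x Fx; rewrite leNgt; apply/negP => ?.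
  by apply: nob; exists (w x); first exact: wI.
have [c supp] := convex_support_line Phi_convex Ia Ib It at_ tb.
have wci : mu.-integrable F (EFin \o (w \- cst (mean w))).
  exact: integrableB wi (integrable_cst_fin _).
have cwi : mu.-integrable F (EFin \o (fun x => c * (w x - mean w))).
  exact: (integrableZl _ c wci).
have -> : Phi (mean w) = mean (fun x => cst (Phi (mean w)) x + c * (w x - mean w)).
  rewrite /mean RintegralD//; last exact: integrable_cst_fin.
  rewrite RintegralZl// RintegralB//; last exact: integrable_cst_fin.
  rewrite !Rintegral_cst// wE -/m.
  have m0 : m != 0 by rewrite gt_eqF// fine_measure_gt0.
  by rewrite mulKf// [mean w * m]mulrC subrr mulr0 addr0 [_ * m]mulrC mulKf.
rewrite ler_pM2l ?invr_gt0 ?fine_measure_gt0//.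
apply: le_Rintegral => //.
  exact: integrableD (integrable_cst_fin _) cwi.
by move=> x /wI; exact: supp.
Qed.

End mean.

(** * The theorem *)

Theorem mainTheorem4 (R : realType) (d : measure_display) (T : measurableType d)
    (I : set R) (Phi : R -> R)
    (mu : {finite_measure set T -> \bar R}) (nu : {measure set T -> \bar R})
    (Du Dv : set T) (u v : T -> R)
    (I_nonempty : I !=set0) (I_connected : connected I)
    (Phi_convex : convex_function (I : set (convex_lmodType R^o)) Phi)
    (* (1) *)
    (mu_neq0 : exists2 A : set T, measurable A & mu A <> 0%E)
    (mu_le_nu : forall A : set T, measurable A -> (mu A <= nu A)%E)
    (* (2) *)
    (im_connected : connected (Phi @` I))
    (sup_inv_increasing : forall y1 y2 : R, (Phi @` I) y1 -> (Phi @` I) y2 ->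
       y1 <= y2 -> (sup_inv I Phi y1 <= sup_inv I Phi y2)%E)
    (* (3) *)
    (u_L1 : in_L1 mu Du u) (v_L1 : in_L1 mu Dv v)
    (uv_in_I : {ae mu, forall x, comp_sub_dom I Du u Dv v x})
    (Phi_uv_L1 :
       in_L1 nu (comp_sub_dom I Du u Dv v) (fun x => Phi (u x - v x)))
    (* (4) *)
    (Phi_uv_ge0 : exists Y : set T,
       [/\ measurable Y,
           (nu (~` Y) - mu (~` Y) = 0)%E
         & forall x, Y x ->
             comp_sub_dom I Du u Dv v x /\ 0 <= Phi (u x - v x)])
    (mean_in_im : (Phi @` I)
       ((fine (mu [set: T]))^-1 *
        \int[nu]_(x in comp_sub_dom I Du u Dv v) Phi (u x - v x))) :
  let m := fine (mu [set: T]) in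
  let y := m^-1 *
        \int[nu]_(x in comp_sub_dom I Du u Dv v) Phi (u x - v x) in
  ((m^-1 * \int[mu]_(x in Du) u x)%:E <=
     (m^-1 * \int[mu]_(x in Dv) v x)%:E + sup_inv I Phi y)%E /\
  ({in I &, {homo Phi : s t / s < t}} ->
   m^-1 * \int[mu]_(x in Du) u x <=
     m^-1 * \int[mu]_(x in Dv) v x + 'pinv_(fun=> 0) I Phi y).
Proof.
move=> m y.
have itvI : is_interval I by exact/connected_intervalP.
have [Eu [mEu EuDu Eu0 ui]] := u_L1.
have [Ev [mEv EvDv Ev0 vi]] := v_L1.
have [E [mE ED numuE Phi_nu]] := Phi_uv_L1.
have [Y [mY numuY Y_ge0]] := Phi_uv_ge0.
have E0 : mu (~` E) = 0%E.
  apply/eqP; rewrite eq_le measure_ge0 andbT -numuE.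
  by apply: mu_le_nu; exact: measurableC.
(* F is full for mu only: Eu and Ev may miss a set of positive nu-measure, so
   the integrals for mu and nu are compared on E rather than on F *)
pose F := E `&` (Eu `&` Ev).
have mF : measurable F by do 2 apply: measurableI => //.
have F0 : mu (~` F) = 0%E by do 2 (apply: null_setCI => //; try exact: measurableI).
have FE : F `<=` E by move=> x [].
have FEu : F `<=` Eu by move=> x [_ []].
have FEv : F `<=` Ev by move=> x [_ []].
have muF : mu F = mu [set: T] by exact: measure_full_set.
have muF_neq0 : mu F != 0%E.
  rewrite muF; have [A mA /eqP] := mu_neq0; apply: contra => /eqP T0.
  by rewrite (subset_measure0 _ _ (@subsetT _ A) T0).
have muF_fin : (mu F < +oo)%E by rewrite ltey_eq fin_num_measure.
have m_gt0 : 0 < m by rewrite /m -muF fine_measure_gt0.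
have meanE f : mean mu F f = m^-1 * \int[mu]_(x in F) f x.
  by rewrite /m -muF.
have uiF : mu.-integrable F (EFin \o u) by exact: integrableS ui.
have viF : mu.-integrable F (EFin \o v) by exact: integrableS vi.
have Phi_mu : mu.-integrable E (EFin \o (fun x => Phi (u x - v x))).
  exact: le_measure_integrable Phi_nu.
pose w x := u x - v x.
have wi : mu.-integrable F (EFin \o w) by exact: integrableB uiF viF.
have wI x : F x -> I (w x) by move=> /FE/ED[].
pose t := mean mu F w.
have It : I t by exact: mean_in_interval.
have le_y : Phi t <= y.
  apply: le_trans (Jensen_inequality mF muF_neq0 muF_fin wi itvI Phi_convex wI _) _.
    exact: integrableS Phi_mu.
  rewrite meanE /y ler_pM2l ?invr_gt0// (Rintegral_full_subset _ mE ED numuE).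
  rewrite -(Rintegral_full_subset _ mF FE F0).
  apply: (le_measure_Rintegral mu_le_nu (Y := Y)) => //.
  - by move=> x /Y_ge0[].
  - by rewrite ltey_eq fin_num_measure//; exact: measurableC.
have mean_u : m^-1 * \int[mu]_(x in Du) u x = m^-1 * \int[mu]_(x in Dv) v x + t.
  rewrite (Rintegral_full_subset _ mF (subset_trans FEu EuDu) F0).
  rewrite (Rintegral_full_subset _ mF (subset_trans FEv EvDv) F0).
  by rewrite /t meanE RintegralB// -mulrDr addrC subrK.
have t_le : (t%:E <= sup_inv I Phi y)%E.
  apply: (@le_trans _ _ (sup_inv I Phi (Phi t))).
    by apply: ereal_sup_ubound; exists t.
  by apply: sup_inv_increasing => //; exists t.
split; first by rewrite mean_u EFinD leeD2l.
move=> Phi_incr; rewrite mean_u lerD2l.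
have Phi_inj : {in I &, injective Phi}.
  move=> s r Is Ir eq_sr; have [sr|rs|//] := ltgtP s r.
  - by have := Phi_incr _ _ Is Ir sr; rewrite eq_sr ltxx.
  - by have := Phi_incr _ _ Ir Is rs; rewrite eq_sr ltxx.
have [s Is sy] := mean_in_im.
rewrite -/m -/y in sy.
rewrite -sy pinvKV ?inE// leNgt; apply/negP => st.
have := Phi_incr _ _ (mem_set Is) (mem_set It) st.
by rewrite sy ltNge le_y.
Qed.
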